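(* Let $u\in(2,\infty)$ and let $(K_n)_{n\ge1}$ be a sequence of positive integers with $\lim_{n\to\infty}K_n/(u\,n^{1/2})=1$. Then for all positive integers $m,n$ and all $t\in(0,\infty)$, $$\ln\left(\mathcal{F}^+_{\mu_{m,n}}\big(f^{(K_n)}_{m,n};\,t\,n^{1/4}\big)\right)\le \varkappa-\vartheta\left(2t\sqrt{\frac{n^{1/2}}{K_n}}\right).$$ In particular, for fixed $t\in(0,\infty)$ the right-hand side converges to $\varkappa-\vartheta(2t/u^{1/2})$ as $n\to\infty$.
   Context: For positive integers $m,n$, let $A_m=\{0,\frac1m,\frac2m,\dots,1\}$ and $\mathcal{X}_{m,n}=A_m^n$, and let $\mu_{m,n}$ be the uniform probability measure on $\mathcal{X}_{m,n}$. The length of the longest increasing subsequence is $f_n:[0,1]^n\to\mathbb{R}$, $f_n(x_1,\dots,x_n)=\max\{|J|: J\subset\{1,\dots,n\},\ \forall i,j\in J,\ i<j\Rightarrow x_i<x_j\}$. For a positive integer $K$, its truncation is $f_n^{(K)}=\min\{K,f_n\}$, and $f^{(K)}_{m,n}$ is the restriction of $f_n^{(K)}$ to $A_m^n$. For a probability measure $\mu$ on a finite set $\mathcal{X}$, $f:\mathcal{X}\to\mathbb{R}$ and $a\ge0$, the positive fluctuation function is $\mathcal{F}^+_\mu(f;a)=\mu(\{x: f(x)-\mathbb{E}_\mu[f]\ge a\})$; convention $\ln 0=-\infty$. The constant is $\varkappa=\sum_{k=1}^\infty 2^k\ln\left(\frac{1}{1-4^{-k}}\right)$, and, for $x>0$,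 $\vartheta(x)=x\,\varphi(x)+\ln\left(\frac2x\varphi(x)\right)$ with $\varphi(x)=\sqrt{1+\frac1{x^2}}-\frac1x$. *)

(* Defs.v *)
From HB Require Import structures.
From mathcomp Require Import all_boot all_order all_algebra.
From mathcomp Require Import all_classical all_reals all_analysis.
Import Order.TTheory GRing.Theory Num.Theory.
Import numFieldNormedType.Exports.

Set Implicit Arguments.
Unset Strict Implicit.
Unset Printing Implicit Defensive.

Local Open Scope ring_scope.

(* A probability measure on a finite set is given by its point masses. *)
Record fin_prob (R : realType) (T : finType) := FinProb {
  pmass :> T -> R;
  pmass_ge0 : forall x, 0 <= pmass x;
  pmass_sum1 : \sum_x pmass x = 1 }.

Definition prob (R : realType) (T : finType) (mu : fin_prob R T) (A : {set T}) : R :=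
  \sum_(x in A) mu x.

Definition expect (R : realType) (T : finType) (mu : fin_prob R T) (f : T -> R) : R :=
  \sum_x mu x * f x.

Definition fluct_pos (R : realType) (T : finType) (mu : fin_prob R T)
    (f : T -> R) (a : R) : R :=
  prob mu [set x | a <= f x - expect mu f].

Lemma unif_ge0 (R : realType) (T : finType) :
  T -> 0 <= (#|T|%:R^-1 : R).
Proof. by move=> _; rewrite invr_ge0 ler0n. Qed.

Lemma unif_sum1 (R : realType) (T : finType) (hT : (0 < #|T|)%N) :
  \sum_(x : T) (#|T|%:R^-1 : R) = 1.
Proof.
rewrite sumr_const -[X in X *+ _]mul1r -mulrnAr -[X in _ * X]mulr_natr.
by rewrite mul1r mulVf// pnatr_eq0 -lt0n.
Qed.

Definition unif (R : realType) (T : finType) (hT : (0 < #|T|)%N) : fin_prob R T :=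
  @FinProb R T (fun=> #|T|%:R^-1) (@unif_ge0 R T) (unif_sum1 R hT).

Definition A_ (R : realType) (m : nat) : seq R :=
  [seq k%:R / m%:R | k <- iota 0 m.+1].

(* [seq_sub (A_ R m)] is the finite subtype of the reals lying in [A_ R m]. *)
Definition X_ (R : realType) (m n : nat) : finType :=
  {ffun 'I_n -> seq_sub (A_ R m)}.

Lemma A_0 (R : realType) (m : nat) : (0 : R) \in A_ R m.
Proof. by apply/mapP; exists 0%N; rewrite ?mem_iota// mul0r. Qed.

Lemma card_X_gt0 (R : realType) (m n : nat) : (0 < #|X_ R m n|)%N.
Proof. by apply/card_gt0P; exists [ffun=> SeqSub (A_0 R m)]. Qed.

Definition mu_ (R : realType) (m n : nat) : fin_prob R (X_ R m n) :=
  unif R (card_X_gt0 R m n).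

Definition increasing_on (R : realType) (n : nat) (x : 'I_n -> R)
    (J : {set 'I_n}) : bool :=
  [forall i in J, forall j in J, (i < j)%N ==> (x i < x j)].

Definition lis (R : realType) (n : nat) (x : 'I_n -> R) : R :=
  (\max_(J : {set 'I_n} | increasing_on x J) #|J|)%:R.

Definition lis_trunc (R : realType) (n K : nat) (x : 'I_n -> R) : R :=
  Num.min K%:R (lis x).

Definition lis_trunc_grid (R : realType) (m n K : nat) (x : X_ R m n) : R :=
  lis_trunc K (fun i => val (x i)).

Definition varkappa (R : realType) : R :=
  limn (fun N => \sum_(1 <= k < N) 2 ^+ k * ln (1 / (1 - 4 ^- k))).

Definition varphi (R : realType) (x : R) : R :=
  Num.sqrt (1 + 1 / x ^+ 2) - 1 / x.

Definition vartheta (R : realType) (x : R) : R :=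
  x * varphi x + ln (2 / x * varphi x).

(* Main.v *)
(* Write [f] for the truncated length. Removing a coordinate from consideration
   lowers [f] by 0 or 1, and lowers it for at most [K] coordinates, so the
   Efron-Stein inequality applied to [expR (l * f)] bounds its variance by
   [l ^+ 2 * K] times its second moment. For
   [M s = E (expR (s * (2 / sqrt K) * (f - E f)))] this reads
   [M s * (1 - s ^+ 2) <= M (s / 2) ^+ 2]; iterating it down to 0 gives
   [M s <= expR varkappa / (1 - s ^+ 2)] for [0 <= s < 1], and [vartheta] is the
   resulting Chernoff exponent. *)
Require Import Defs.
From HB Require Import structures.
From mathcomp Require Import all_boot all_order all_algebra.
From mathcomp Require Import all_classical all_reals all_analysis.
From mathcomp Require Import ring lra.
Import Order.TTheory GRing.Theory Num.Theory.
Import numFieldNormedType.Exports.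

Local Open Scope ring_scope.

(** * Expectation on a finite probability space *)

Section FiniteExpectation.
Context {R : realType} {T : finType} (mu : fin_prob R T).
Implicit Types (f g : T -> R) (c : R).

Lemma eq_expect f g : f =1 g -> expect mu f = expect mu g.
Proof. by move=> fg; apply: eq_bigr => x _; rewrite fg. Qed.

Lemma expectD f g :
  expect mu (fun x => f x + g x) = expect mu f + expect mu g.
Proof. by rewrite -big_split; apply: eq_bigr => x _; rewrite mulrDr. Qed.

Lemma expectZ c f : expect mu (fun x => c * f x) = c * expect mu f.
Proof. by rewrite big_distrr; apply: eq_bigr => x _; rewrite mulrCA. Qed.

Lemma expectB f g :
  expect mu (fun x => f x - g x) = expect mu f - expect mu g.
Proof. by rewrite -sumrB; apply: eq_bigr => x _; rewrite mulrBr. Qed.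

Lemma expect_sum (I : finType) (F : I -> T -> R) :
  expect mu (fun x => \sum_i F i x) = \sum_i expect mu (F i).
Proof. by rewrite exchange_big; apply: eq_bigr => x _; rewrite mulr_sumr. Qed.

Lemma expect_cst c : expect mu (fun=> c) = c.
Proof. by rewrite /expect -mulr_suml pmass_sum1 mul1r. Qed.

Lemma le_expect f g : (forall x, f x <= g x) -> expect mu f <= expect mu g.
Proof. by move=> fg; apply: ler_sum => x _; rewrite ler_wpM2l// pmass_ge0. Qed.

Lemma expect_ge0 f : (forall x, 0 <= f x) -> 0 <= expect mu f.
Proof. by move=> f0; rewrite -(expect_cst 0); exact: le_expect. Qed.

End FiniteExpectation.

(** * Coordinate averages and the Efron-Stein inequality *)

Section CoordinateAveraging.
Context {R : realType} {I T : finType}.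
Local Notation X := {ffun I -> T}.
Implicit Types (g h : X -> R) (x y : X) (i j : I) (s : seq I).

Definition upd x i (a : T) : X := [ffun j => if j == i then a else x j].

(** Under the uniform measure this is the conditional expectation of [g] given all coordinates other
    than [i]. *)
Definition avg i g x : R := #|T|%:R^-1 * \sum_a g (upd x i a).

Definition avgs s g := foldl (fun h i => avg i h) g s.

Lemma upd_id x i : upd x i (x i) = x.
Proof. by apply/ffunP => j; rewrite ffunE; case: eqP => // ->. Qed.

Lemma upd_upd x i a b : upd (upd x i a) i b = upd x i b.
Proof. by apply/ffunP => j; rewrite !ffunE; case: eqP. Qed.

Lemma updC x i j a b : i != j -> upd (upd x i a) j b = upd (upd x j b) i a.
Proof.
move=> ij; apply/ffunP => k; rewrite !ffunE.
by case: eqP => // ->; rewrite eq_sym (negbTE ij).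
Qed.

Lemma cardT_neq0 x i : #|T|%:R != 0 :> R.
Proof. by rewrite pnatr_eq0 -lt0n; apply/card_gt0P; exists (x i). Qed.

Lemma sum_avg i g : \sum_x avg i g x = \sum_x g x.
Proof.
have -> : \sum_x avg i g x = \sum_x \sum_(a : T) #|T|%:R^-1 * g x.
  rewrite /avg; under eq_bigr do rewrite mulr_sumr.
  rewrite !pair_bigA/=.
  (* The reindexing map swaps [a] with the [i]-th coordinate of [x]; it is an involution. *)
  rewrite [RHS](reindex_inj (h := fun p : X * T => (upd p.1 i p.2, p.1 i)))//.
  move=> [x a] [y b] /= [xy xyi].
  have := congr1 (fun z : X => z i) xy; rewrite !ffunE eqxx => ->.
  have := congr1 (fun z => upd z i (x i)) xy.
  by rewrite !upd_upd upd_id xyi upd_id => ->.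
apply: eq_bigr => x _.
by rewrite sumr_const -[LHS]mulr_natr mulrAC mulVf ?mul1r// (cardT_neq0 x i).
Qed.

Lemma avgB i g h x : avg i (fun y => g y - h y) x = avg i g x - avg i h x.
Proof. by rewrite /avg sumrB mulrBr. Qed.

Lemma avg_upd i g x a : avg i g (upd x i a) = avg i g x.
Proof. by rewrite /avg; under eq_bigr do rewrite upd_upd. Qed.

Lemma avgMr i g h x : (forall a, h (upd x i a) = h x) ->
  avg i (fun y => g y * h y) x = avg i g x * h x.
Proof.
by move=> hi; rewrite /avg; under eq_bigr do rewrite hi; rewrite -mulr_suml mulrA.
Qed.

Lemma avg_invar i h x : (forall a, h (upd x i a) = h x) -> avg i h x = h x.
Proof.
move=> hi; rewrite /avg; under eq_bigr do rewrite hi.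
by rewrite sumr_const -[X in _ * X]mulr_natl mulKf// (cardT_neq0 x i).
Qed.

Lemma avgC i j g x : avg i (avg j g) x = avg j (avg i g) x.
Proof.
have [->//|ij] := eqVneq i j.
rewrite /avg; under eq_bigr do rewrite mulr_sumr.
rewrite exchange_big; congr (_ * _); apply: eq_bigr => a _.
rewrite mulr_sumr; apply: eq_bigr => b _; rewrite updC//.
Qed.

Section Variance.
Context (hX : (0 < #|X|)%N).
Local Notation E := (expect (unif R hX)).

Lemma expect_avg i g : E (avg i g) = E g.
Proof. by rewrite -[LHS]mulr_sumr -[RHS]mulr_sumr sum_avg. Qed.

(** Pythagoras: [avg i] is an orthogonal projection in L2. The cross term reduces because [avg i g]
    is constant along coordinate [i]. *)
Lemma expect_sqr_avg i g :
  E (fun x => g x ^+ 2) - E (fun x => avg i g x ^+ 2) =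
  E (fun x => (g x - avg i g x) ^+ 2).
Proof.
have gA : E (fun x => g x * avg i g x) = E (fun x => avg i g x ^+ 2).
  rewrite -(expect_avg i); apply: eq_expect => x.
  by rewrite avgMr ?expr2// => a; exact: avg_upd.
have -> : E (fun x => (g x - avg i g x) ^+ 2) =
    E (fun x => (g x ^+ 2 - 2 * (g x * avg i g x)) + avg i g x ^+ 2).
  by apply: eq_expect => x; ring.
by rewrite expectD expectB expectZ gA; ring.
Qed.

Lemma expect_sqr_avg_le i g : E (fun x => avg i g x ^+ 2) <= E (fun x => g x ^+ 2).
Proof.
by rewrite -subr_ge0 expect_sqr_avg; apply: expect_ge0 => x; exact: sqr_ge0.
Qed.

(** A projection is the best L2 approximation: Pythagoras applied to [g - h], whose average is
    [avg i g - h]. *)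
Lemma expect_sqr_dev_le i g h : (forall x a, h (upd x i a) = h x) ->
  E (fun x => (g x - avg i g x) ^+ 2) <= E (fun x => (g x - h x) ^+ 2).
Proof.
move=> hi; have avgi x : avg i (fun y => g y - h y) x = avg i g x - h x.
  by rewrite avgB (avg_invar i h).
have -> : E (fun x => (g x - avg i g x) ^+ 2) =
    E (fun x => ((g x - h x) - avg i (fun y => g y - h y) x) ^+ 2).
  by apply: eq_expect => x; rewrite avgi; ring.
rewrite -expect_sqr_avg lerBlDr lerDl.
by apply: expect_ge0 => x; exact: sqr_ge0.
Qed.

Lemma expect_avgs s g : E (avgs s g) = E g.
Proof. by elim: s g => //= i s IH g; rewrite IH expect_avg. Qed.

Lemma expect_sqr_avgs s g :
  E (fun x => g x ^+ 2) - E (fun x => avgs s g x ^+ 2) <=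
  \sum_(i <- s) E (fun x => (g x - avg i g x) ^+ 2).
Proof.
elim: s g => [|i s IH] g; first by rewrite subrr big_nil.
rewrite big_cons -(expect_sqr_avg i) -lerBlDl.
rewrite opprB addrC addrA subrK.
apply: le_trans (IH _) _; apply: ler_sum => j _.
(* Averages commute, so the deviation of [avg i g] along [j] is the [i]-average of that of [g], and
   averaging contracts the L2 norm. *)
have -> : E (fun x => (avg i g x - avg j (avg i g) x) ^+ 2) =
    E (fun x => avg i (fun y => g y - avg j g y) x ^+ 2).
  by apply: eq_expect => x; rewrite avgB (avgC i j).
exact: expect_sqr_avg_le.
Qed.

(** [D] records coordinates on which [g] does not depend; each average adds one. Starting from
    [pred0], averaging over all of [I] leaves a constant. *)
Lemma avgs_eq s (D : {pred I}) g x y :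
  (forall x y, (forall j, j \notin D -> x j = y j) -> g x = g y) ->
  (forall j, j \notin [predU D & s] -> x j = y j) -> avgs s g x = avgs s g y.
Proof.
elim: s D g x y => [|i s IH] D g x y gD xy /=.
  by apply: gD => j jD; apply: xy; rewrite !inE/= orbF.
apply: (IH [predU1 i & D]); last first.
  by move=> j; rewrite !inE => jis; apply: xy; rewrite !inE orbCA orbA.
move=> {}x {}y {}xy; rewrite /avg; congr (_ * _); apply: eq_bigr => a _.
apply: gD => j jD; rewrite !ffunE; case: eqP => // /eqP ji.
by apply: xy; rewrite !inE negb_or ji.
Qed.

Lemma avgs_enum g x y : avgs (enum I) g x = avgs (enum I) g y.
Proof.
apply: (avgs_eq _ pred0) => [{}x {}y xy|j]; last by rewrite !inE mem_enum.
by congr g; apply/ffunP => j; exact: xy.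
Qed.

(* Telescoping the second moment along coordinatewise averages; the resulting
   coordinate variances are minimal among deviations from functions that do not
   depend on that coordinate. *)
Lemma efron_stein g (h : I -> X -> R) :
  (forall i x a, h i (upd x i a) = h i x) ->
  E (fun x => g x ^+ 2) - (E g) ^+ 2 <= \sum_i E (fun x => (g x - h i x) ^+ 2).
Proof.
move=> hi; have [x0 _] : exists x, x \in X by apply/card_gt0P.
have Eg : E g = avgs (enum I) g x0.
  rewrite -(expect_avgs (enum I)) -(expect_cst (unif R hX) (avgs _ g x0)).
  by apply: eq_expect => x; exact: avgs_enum.
have -> : E g ^+ 2 = E (fun x => avgs (enum I) g x ^+ 2).
  rewrite Eg -[LHS](expect_cst (unif R hX)).
  by apply: eq_expect => x; rewrite (avgs_enum g x0 x).
apply: le_trans (expect_sqr_avgs _ _) _.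
rewrite big_enum/=; apply: ler_sum => i _.
exact: expect_sqr_dev_le.
Qed.

End Variance.
End CoordinateAveraging.

(** * Variance of the exponential of a self-bounding function *)

Section SelfBounding.
Context {R : realType} {I T : finType} (hX : (0 < #|{ffun I -> T}|)%N).
Local Notation E := (expect (unif R hX)).

Lemma expect_expR_self_bounding (f : {ffun I -> T} -> R)
    (fi : I -> {ffun I -> T} -> R) (V l : R) :
  0 <= l ->
  (forall i x a, fi i (upd x i a) = fi i x) ->
  (forall i x, fi i x <= f x) ->
  (forall x, \sum_i (f x - fi i x) ^+ 2 <= V) ->
  E (fun x => expR (l * f x) ^+ 2) - E (fun x => expR (l * f x)) ^+ 2 <=
  l ^+ 2 * V * E (fun x => expR (l * f x) ^+ 2).
Proof.
move=> l0 fi_upd fi_le fV.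
apply: le_trans (efron_stein hX _ (fun i x => expR (l * fi i x)) _) _.
  by move=> i x a; rewrite fi_upd.
rewrite -expect_sum -expectZ; apply: le_expect => x.
apply: (@le_trans _ _ (\sum_i l ^+ 2 * (f x - fi i x) ^+ 2 * expR (l * f x) ^+ 2)).
  apply: ler_sum => i _; rewrite -!exprMn.
  have d0 : 0 <= l * (f x - fi i x) by rewrite mulr_ge0// subr_ge0.
  have e0 : 0 <= expR (l * f x) - expR (l * fi i x).
    by rewrite subr_ge0 ler_expR ler_wpM2l.
  rewrite ler_pXn2r// ?nnegrE; last by rewrite mulr_ge0 ?expR_ge0.
  (* Factoring out [expR (l * f x)] leaves [1 - expR (- d) <= d] with [d = l * (f x - fi i x)]. *)
  have -> : l * fi i x = - (l * (f x - fi i x)) + l * f x by ring.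
  rewrite expRD -[X in X - _]mul1r -mulrBl ler_wpM2r ?expR_ge0//.
  have := expR_ge1Dx (- (l * (f x - fi i x))); lra.
rewrite -mulr_suml -mulr_sumr ler_wpM2r ?sqr_ge0//.
by rewrite ler_wpM2l// sqr_ge0.
Qed.

End SelfBounding.

(** * Convergence of the series [varkappa] and bounds on the exponential *)

Section Varkappa.
Context {R : realType}.

Let kterm (k : nat) : R := 2 ^+ k * ln (1 / (1 - 4 ^- k)).

Let inv4X_itv (k : nat) : (0 < k)%N -> 0 <= (4 ^- k : R) <= 4^-1.
Proof.
case: k => // k _; rewrite invr_ge0 exprn_ge0//=.
by rewrite lef_pV2 ?posrE ?exprn_gt0// exprS ler_pMr// exprn_ege1// ler1n.
Qed.

Let kterm_ge0 (k : nat) : (0 < k)%N -> 0 <= kterm k.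
Proof.
move=> /inv4X_itv/andP[q0 q4]; rewrite mulr_ge0 ?exprn_ge0// ln_ge0//.
by rewrite mul1r invf_ge1; lra.
Qed.

(** With [q = 4 ^- k <= 1 / 4], the logarithm is [ln (1 + q / (1 - q)) <= q / (1 - q) <= 2 * q],
    which gives a geometric majorant. *)
Let kterm_le (k : nat) : (0 < k)%N -> kterm k <= 2 * 2 ^- k.
Proof.
move=> k0; have /andP[q0 q4] := inv4X_itv _ k0.
have -> : 2 * 2 ^- k = 2 ^+ k * (2 * 4 ^- k) :> R.
  have -> : 4 = 2 * 2 :> R by ring.
  by rewrite exprMn; field; rewrite expf_neq0.
rewrite ler_wpM2l ?exprn_ge0//.
apply: (@le_trans _ _ (4 ^- k / (1 - 4 ^- k))); last first.
  by rewrite ler_pdivrMr; nra.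
have -> : 1 / (1 - 4 ^- k) = 1 + 4 ^- k / (1 - 4 ^- k) :> R.
  by move: q0 q4; set q := 4 ^- k => q0 q4; field; lra.
apply: le_ln1Dx; apply: (@lt_le_trans _ _ 0); first by rewrite oppr_lt0.
by rewrite divr_ge0//; lra.
Qed.

(** [varkappa] is a [limn], meaningful only once convergence is known: the partial sums are
    nondecreasing and bounded by 2. *)
Lemma le_varkappa (N : nat) :
  \sum_(1 <= k < N.+1) 2 ^+ k * ln (1 / (1 - 4 ^- k)) <= varkappa R.
Proof.
have ub n : \sum_(1 <= k < n) kterm k <= 2.
  (* The right-hand side is the exact partial sum of the geometric majorant, so the induction
     closes. *)
  suff : \sum_(1 <= k < n.+1) kterm k <= 2 - 2 * 2 ^- n.
    case: n => [|n] H; first by rewrite big_geq.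
    rewrite big_nat_recr//= in H.
    have := kterm_ge0 n.+1 isT; have : 0 <= 2 ^- n.+1 :> R by rewrite invr_ge0 exprn_ge0.
    by lra.
  elim: n => [|n IH]; first by rewrite big_geq// expr0 invr1 mulr1 subrr.
  rewrite big_nat_recr//=; have := kterm_le n.+1 isT.
  by rewrite exprS invfM; lra.
have mono : {homo (fun n => \sum_(1 <= k < n) kterm k) : n m / (n <= m)%N >-> n <= m}.
  by apply: nondecreasing_series => n n0 _; exact: kterm_ge0.
apply: (nondecreasing_cvgn_le mono); apply: nondecreasing_is_cvgn => //.
by exists 2 => _ [n _ <-].
Qed.

Lemma expR_kterm (k : nat) : (0 < k)%N ->
  expR (2 ^+ k * ln (1 / (1 - 4 ^- k))) = (1 / (1 - 4 ^- k : R)) ^+ (2 ^ k).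
Proof.
move=> k0; have /andP[q0 q4] := inv4X_itv _ k0.
by rewrite -natrX expRM_natl lnK// posrE divr_gt0//; lra.
Qed.

(** From [expR y <= 1 / (1 - y)] and [(1 + y + 2 * y ^+ 2) * (1 - y) = 1 + y ^+ 2 * (1 - 2 * y)],
    which is at least 1 when [y <= 1 / 2]. *)
Lemma expR_le_quadratic (y : R) : y <= 2^-1 -> expR y <= 1 + y + 2 * y ^+ 2.
Proof.
move=> y2; have := expR_ge1Dx (- y); rewrite expRN => ey.
have y1 : 0 < 1 - y by lra.
have : expR y <= (1 - y)^-1.
  by rewrite -[leLHS]invrK lef_pV2 ?posrE ?invr_gt0 ?expR_gt0//; lra.
move/le_trans; apply; rewrite -[leLHS]mul1r ler_pdivrMr//.
have : 0 <= y ^+ 2 by exact: sqr_ge0.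
by nra.
Qed.

End Varkappa.

(** * Iteration of the halving inequality for the Laplace transform *)

Section LaplaceTransform.
Local Open Scope classical_set_scope.
Context {R : realType} {T : finType} (mu : fin_prob R T) (g : T -> R).
Local Notation M := (fun s : R => expect mu (fun x => expR (s * g x))).

Hypothesis g_centered : expect mu g = 0.

Lemma mgf_le_expR_sqr (B h : R) : (forall x, `|g x| <= B) -> 0 <= h ->
  h * B <= 2^-1 -> M h <= expR (2 * B ^+ 2 * h ^+ 2).
Proof.
move=> gB h0 hB; apply: le_trans (expR_ge1Dx _).
(* The linear term [h * g x] has mean zero, so it can be inserted to match the quadratic bound on
   [expR]. *)
have -> : 1 + 2 * B ^+ 2 * h ^+ 2 =
    expect mu (fun x => (1 + 2 * B ^+ 2 * h ^+ 2) + h * g x).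
  by rewrite expectD expect_cst expectZ g_centered mulr0 addr0.
apply: le_expect => x; have := gB x; rewrite ler_norml => /andP[gl gu].
apply: le_trans (expR_le_quadratic _ _) _.
  by apply: le_trans hB; rewrite ler_wpM2l.
have : h ^+ 2 * g x ^+ 2 <= h ^+ 2 * B ^+ 2.
  by rewrite ler_wpM2l ?sqr_ge0//; nra.
by rewrite exprMn; lra.
Qed.

Hypothesis M_half : forall s : R, 0 <= s -> M s * (1 - s ^+ 2) <= M (s / 2) ^+ 2.

Let M_ge0 s : 0 <= M s.
Proof. by apply: expect_ge0 => x; exact: expR_ge0. Qed.

(** The first halving yields [1 - s ^+ 2]. A later one, at [s / 2 ^+ k], costs at most
    [1 / (1 - 4 ^- k)] since [s < 1]; raised to the power [2 ^ k], this is the exponential of the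
    [k]-th term of [varkappa]. *)
Let M_half_iter (s : R) (N : nat) : 0 <= s < 1 ->
  M s * (1 - s ^+ 2) <=
  expR (\sum_(1 <= k < N.+1) 2 ^+ k * ln (1 / (1 - 4 ^- k))) *
  M (s / 2 ^+ N.+1) ^+ (2 ^ N.+1).
Proof.
move=> /andP[s0 s1]; elim: N => [|N IH].
  by rewrite big_geq// expR0 mul1r expr1; exact: M_half.
apply: le_trans IH _; rewrite [in leRHS]big_nat_recr//= expRD -mulrA.
rewrite ler_wpM2l ?expR_ge0// expR_kterm// (expnS 2 N.+1) exprM -exprMn.
have q0 : 0 < 4 ^- N.+1 :> R by rewrite invr_gt0 exprn_gt0.
have q1 : 4 ^- N.+1 < 1 :> R by rewrite invf_lt1 ?exprn_gt0// exprn_egt1// ltr1n.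
have d0 : 0 < 1 - 4 ^- N.+1 :> R by rewrite subr_gt0.
rewrite ler_pXn2r ?expn_gt0 ?nnegrE ?mulr_ge0 ?sqr_ge0 ?invr_ge0 ?(ltW d0)//.
rewrite mul1r [leRHS]mulrC ler_pdivlMr//.
have r0 : 0 <= s / 2 ^+ N.+1 by rewrite divr_ge0 ?exprn_ge0.
have -> : s / 2 ^+ N.+2 = s / 2 ^+ N.+1 / 2.
  by rewrite (exprSr _ N.+1) invfM mulrA.
apply: le_trans (M_half _ r0); rewrite ler_wpM2l// lerB//.
have -> : (s / 2 ^+ N.+1) ^+ 2 = s ^+ 2 * 4 ^- N.+1.
  have -> : 4 = 2 ^+ 2 :> R by ring.
  by rewrite expr_div_n -!exprM mulnC.
by rewrite -[leRHS]mul1r ler_wpM2r ?(ltW q0)//; nra.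
Qed.

(* Iterating the halving inequality leaves the factor
   [M (s / 2 ^ n) ^ (2 ^ n)], which tends to 1 because [g] is centered. *)
Lemma mgf_le (s : R) : 0 <= s < 1 -> M s * (1 - s ^+ 2) <= expR (varkappa R).
Proof.
move=> s01; have /andP[s0 s1] := s01.
pose B := \sum_x `|g x|.
have B0 : 0 <= B by apply: sumr_ge0.
have gB x : `|g x| <= B by rewrite /B (bigD1 x)//= lerDl sumr_ge0.
(* Chosen so that the quadratic exponent at [s / 2 ^+ n], multiplied by [2 ^ n], is [D * 2^-1 ^+ n],
   which tends to 0. *)
pose D := 2 * B ^+ 2 * s ^+ 2.
have geo (c : R) : (c * (2^-1) ^+ n @[n --> \oo] --> (0 : R)).
  by apply: cvg_geometric; rewrite ger0_norm; lra.
have lim : (expR (varkappa R) * expR (D * (2^-1) ^+ n) @[n --> \oo] -->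
    (expR (varkappa R) : R)).
  rewrite -[X in _ --> X]mulr1; apply: cvgM; first exact: cvg_cst.
  have := cvg_comp _ _ (geo D) (@continuous_expR R 0).
  by rewrite expR0; apply.
apply: (cvgr_to_ge lim); near=> n.
have n0 : (0 < n)%N by near: n; exact: nbhs_infty_gt.
have small : s / 2 ^+ n * B <= 2^-1.
  rewrite mulrAC -exprVn; apply: ltW.
  by near: n; apply: (cvgr_lt _ (geo (s * B))); lra.
have h0 : 0 <= s / 2 ^+ n by rewrite divr_ge0 ?exprn_ge0.
(* Index [n.-1] corresponds to [n] halvings. *)
apply: le_trans (M_half_iter s n.-1 s01) _.
rewrite prednK//; apply: ler_pM; rewrite ?expR_ge0 ?exprn_ge0//.
  by rewrite ler_expR -(prednK n0) le_varkappa.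
have -> : D * 2^-1 ^+ n = (2 ^ n)%:R * (2 * B ^+ 2 * (s / 2 ^+ n) ^+ 2).
  by rewrite natrX exprVn /D; field; rewrite expf_neq0.
rewrite expRM_natl ler_pXn2r ?nnegrE ?expR_ge0 ?expn_gt0//.
exact: mgf_le_expR_sqr.
Unshelve. all: by end_near.
Qed.

End LaplaceTransform.

(** * The optimal Chernoff parameter *)

Section VarphiTheory.
Context {R : realType} (x : R) (x0 : 0 < x).

Let varphi_sqr : (varphi x + 1 / x) ^+ 2 = 1 + (1 / x) ^+ 2.
Proof.
by rewrite subrK sqr_sqrtr ?expr_div_n ?expr1n// addr_ge0// divr_ge0 ?sqr_ge0.
Qed.

Lemma varphi_itv : 0 < varphi x < 1.
Proof.
have y0 : 0 < 1 / x by rewrite divr_gt0.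
have : 0 <= varphi x + 1 / x by rewrite subrK sqrtr_ge0.
have := varphi_sqr; set y := 1 / x in y0 *; set p := varphi x => pE p0.
by apply/andP; split; nra.
Qed.

(** This is the stationarity condition in [s] of [x * s + ln (1 - s ^+ 2)], so [vartheta x] is the
    value of that function at [varphi x]. *)
Lemma varphiE : 2 / x * varphi x = 1 - varphi x ^+ 2.
Proof.
have -> : 2 / x = 2 * (1 / x) by rewrite mulrA mulr1.
have := varphi_sqr; nra.
Qed.

Lemma expR_vartheta :
  expR (vartheta x) = expR (x * varphi x) * (1 - varphi x ^+ 2).
Proof.
have /andP[p0 p1] := varphi_itv.
rewrite /vartheta expRD lnK; first by rewrite varphiE.
by rewrite posrE mulr_gt0 ?divr_gt0.
Qed.

End VarphiTheory.

(** * Exponential Markov inequality and Chernoff bound *)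

Lemma fluct_pos_le {R : realType} {T : finType} (mu : fin_prob R T)
    (f Y : T -> R) (a b : R) :
  (forall x, a <= f x - expect mu f -> b <= Y x) ->
  fluct_pos mu f a <= expR (- b) * expect mu (fun x => expR (Y x)).
Proof.
move=> bY; rewrite -expectZ /fluct_pos /prob big_mkcond/=.
apply: ler_sum => x _; rewrite inE; case: ifPn => [/bY bx|_].
  rewrite -[leLHS]mulr1 ler_wpM2l ?pmass_ge0// -expRD -[leLHS](@expR0 R).
  by rewrite ler_expR addrC subr_ge0.
by rewrite mulr_ge0 ?pmass_ge0 ?mulr_ge0 ?expR_ge0.
Qed.

(* [vartheta] is the Legendre transform of [s |-> - ln (1 - s ^+ 2)] on
   [[0, 1)], and the optimal Chernoff parameter is [varphi]. *)
Lemma self_bounding_tail {R : realType} {I T : finType}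
    (hX : (0 < #|{ffun I -> T}|)%N) (f : {ffun I -> T} -> R)
    (fi : I -> {ffun I -> T} -> R) (V a : R) :
  0 < V -> 0 < a ->
  (forall i x b, fi i (upd x i b) = fi i x) ->
  (forall i x, fi i x <= f x) ->
  (forall x, \sum_i (f x - fi i x) ^+ 2 <= V) ->
  fluct_pos (unif R hX) f a <=
  expR (varkappa R - vartheta (2 * a / Num.sqrt V)).
Proof.
move=> V0 a0 fi_upd fi_le fV.
set w := Num.sqrt V; have w0 : 0 < w by rewrite sqrtr_gt0.
have wV : w ^+ 2 = V by rewrite sqr_sqrtr// ltW.
pose m := expect (unif R hX) f.
(* With this scale, [s / 2 * g] is [l * (f - m)] for [l = s / w], and [l ^+ 2 * V = s ^+ 2]. The
   second moment of [expR (l * f)] then corresponds to parameter [s] and its mean to [s / 2]. *)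
pose g x := 2 / w * (f x - m).
have g0 : expect (unif R hX) g = 0.
  by rewrite expectZ expectB expect_cst subrr mulr0.
have M_half (s : R) : 0 <= s ->
    expect (unif R hX) (fun x => expR (s * g x)) * (1 - s ^+ 2) <=
    expect (unif R hX) (fun x => expR (s / 2 * g x)) ^+ 2.
  move=> s0; pose l := s / w; pose k := expR (- (l * m)).
  have half x : expR (s / 2 * g x) = k * expR (l * f x).
    rewrite -expRD; congr expR; rewrite /g /l; field; exact: lt0r_neq0.
  have full x : expR (s * g x) = k ^+ 2 * expR (l * f x) ^+ 2.
    by rewrite -exprMn -half -expRM_natl; congr expR; field.
  under eq_expect do rewrite full.
  under [in leRHS]eq_expect do rewrite half.
  rewrite !expectZ exprMn -mulrA ler_wpM2l ?sqr_ge0//.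
  have l0 : 0 <= l by rewrite divr_ge0// ltW.
  have := expect_expR_self_bounding hX f fi V l l0 fi_upd fi_le fV.
  have -> : l ^+ 2 * V = s ^+ 2.
    by rewrite -wV /l; field; exact: lt0r_neq0.
  by rewrite mulrBr mulr1 [_ * s ^+ 2]mulrC lerBlDr lerBlDl addrC.
set y := 2 * a / w; have y0 : 0 < y by rewrite divr_gt0// mulr_gt0.
set s := varphi y.
have /andP[s0 s1] : 0 < s < 1 by exact: varphi_itv.
have s20 : 0 < 1 - s ^+ 2 by nra.
apply: (@le_trans _ _ (expR (- (y * s)) * expect (unif R hX) (fun x => expR (s * g x)))).
  apply: fluct_pos_le => x ax; rewrite mulrC ler_wpM2l ?(ltW s0)//.
  by rewrite /y [leLHS]mulrAC ler_wpM2l// divr_ge0// ltW.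
rewrite [in leRHS]expRD [in leRHS]expRN expR_vartheta// invfM -expRN.
rewrite [leRHS]mulrCA ler_wpM2l ?expR_ge0// ler_pdivlMr//.
by apply: mgf_le => //; rewrite ltW.
Qed.

(** * Effect of deleting a coordinate on the truncated length *)

Section LongestIncreasingSubsequence.
Context {R : realType} {n : nat}.
Implicit Types (x : 'I_n -> R) (D J : {set 'I_n}) (K : nat).

(** Deletion is encoded by restricting the index sets to [D], so [x] keeps its domain and the result
    remains a function on the full product space. *)
Definition lis_in x D : nat :=
  \max_(J : {set 'I_n} | increasing_on x J && (J \subset D)) #|J|.

Definition lis_trunc_in K x D : R := (minn K (lis_in x D))%:R.

Lemma lis_truncE K x : lis_trunc K x = lis_trunc_in K x [set: 'I_n].
Proof.
rewrite /lis_trunc /lis_trunc_in natr_min; congr (Num.min _ _%:R).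
by apply: eq_bigl => J; rewrite finset.subsetT andbT.
Qed.

Lemma increasing_onS x J J' :
  J' \subset J -> increasing_on x J -> increasing_on x J'.
Proof.
move=> /fintype.subsetP J'J /forall_inP incJ; apply/forall_inP => i /J'J iJ.
by apply/forall_inP => j /J'J jJ; exact: (forall_inP (incJ i iJ)).
Qed.

Lemma eq_increasing_on x x' J :
  {in J, x =1 x'} -> increasing_on x J = increasing_on x' J.
Proof.
move=> xx'; apply: eq_forallb_in => i iJ.
by apply: eq_forallb_in => j jJ; rewrite !xx'.
Qed.

Lemma eq_lis_trunc_in K x x' D :
  {in D, x =1 x'} -> lis_trunc_in K x D = lis_trunc_in K x' D.
Proof.
move=> xx'; congr (minn _ _)%:R; apply: eq_bigl => J.
rewrite andbC [in RHS]andbC; case: (boolP (J \subset D)) => //= /fintype.subsetP JD.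
by apply: eq_increasing_on => i /JD; exact: xx'.
Qed.

Lemma lis_trunc_inS K x D D' :
  D \subset D' -> lis_trunc_in K x D <= lis_trunc_in K x D'.
Proof.
move=> DD'; rewrite ler_nat leq_min geq_minl/= (leq_trans (geq_minr _ _))//.
apply/bigmax_leqP => J /andP[incJ JD].
apply: (leq_bigmax_cond (F := fun J => #|J|)).
by rewrite incJ (fintype.subset_trans JD).
Qed.

Lemma lis_trunc_in_ge K x D J : increasing_on x J -> J \subset D ->
  (#|J| <= K)%N -> #|J|%:R <= lis_trunc_in K x D.
Proof.
move=> incJ JD JK; rewrite ler_nat leq_min JK/=.
by apply: (leq_bigmax_cond (F := fun J => #|J|)); rewrite incJ.
Qed.

Lemma lis_trunc_in_witness K x D : exists J : {set 'I_n},
  [/\ increasing_on x J, J \subset D & lis_trunc_in K x D = #|J|%:R].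
Proof.
pose P J := increasing_on x J && (J \subset D).
have P0 : P finset.set0.
  by rewrite /P finset.sub0set andbT; apply/forall_inP => i; rewrite inE.
have := @bigop.bigmax_eq_arg _ finset.set0 P (fun J : {set 'I_n} => #|J|) P0.
case: arg_maxnP => // J /andP[incJ JD] _ lisE.
(* A maximizer may have more than [K] elements; any [minn K #|J|] of them still form an increasing
   set. *)
have /card_geqP[s [us ss sJ]] := geq_minr K #|J|.
have SJ : [set:: s] \subset J by apply/fintype.subsetP => i; rewrite inE => /sJ.
exists [set:: s]; split; [exact: increasing_onS incJ|exact: fintype.subset_trans JD|].
by rewrite /lis_trunc_in /lis_in lisE cardsE (card_uniqP us) ss.
Qed.

(* Deleting a coordinate outside a witness of the truncated length changes
   nothing, and deleting one inside loses at most 1. *)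
Lemma sum_sqr_lis_trunc_in K x :
  \sum_i (lis_trunc_in K x [set: 'I_n] - lis_trunc_in K x (~: [set i])) ^+ 2 <= K%:R.
Proof.
have [J [incJ _ fJ]] := lis_trunc_in_witness K x [set: 'I_n].
have JK : (#|J| <= K)%N.
  by rewrite -(ler_nat R) -fJ ler_nat geq_minl.
apply: (@le_trans _ _ (\sum_(i in J) (1 : R))); last first.
  by rewrite sumr_const ler_nat.
rewrite [leRHS]big_mkcond/=; apply: ler_sum => i _.
have d0 : lis_trunc_in K x (~: [set i]) <= lis_trunc_in K x [set: 'I_n].
  exact: lis_trunc_inS.
have : (#|J :\ i|%:R : R) <= lis_trunc_in K x (~: [set i]).
  apply: lis_trunc_in_ge; first exact: increasing_onS (finset.subsetDl _ _) incJ.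
    by rewrite finset.setDE finset.subsetIr.
  by apply: leq_trans JK; rewrite subset_leq_card// finset.subsetDl.
have := congr1 (fun k => k%:R : R) (cardsD1 i J); rewrite natrD -fJ.
by case: (i \in J) => /= cJ d1; nra.
Qed.

End LongestIncreasingSubsequence.

(** * Tail bound on the grid and limit of its exponent *)

Lemma lis_trunc_grid_tail {R : realType} (m n K : nat) (a : R) :
  (0 < K)%N -> 0 < a ->
  fluct_pos (mu_ R m n) (@lis_trunc_grid R m n K) a <=
  expR (varkappa R - vartheta (2 * a / Num.sqrt K%:R)).
Proof.
(* Deleting coordinate [i] gives [fi i], with [V = K] whatever the grid and the dimension. *)
move=> K0 a0; apply: (self_bounding_tail (card_X_gt0 R m n) _
  (fun i (x : X_ R m n) => lis_trunc_in K (fun j => val (x j)) (~: [set i])))=> //.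
- by rewrite ltr0n.
- move=> i x b; apply: eq_lis_trunc_in => j.
  by rewrite !inE ffunE => /negbTE ->.
- by move=> i x; rewrite /lis_trunc_grid lis_truncE; exact: lis_trunc_inS.
- move=> x; rewrite /lis_trunc_grid; under eq_bigr do rewrite lis_truncE.
  exact: sum_sqr_lis_trunc_in.
Qed.

Lemma vartheta_continuous {R : realType} (x : R) :
  0 < x -> {for x, continuous (@vartheta R)}.
Proof.
move=> x0.
have cinv : {for x, continuous (fun y : R => y^-1)}.
  by apply: continuousV; [exact: lt0r_neq0|exact: cvg_id].
have cphi : {for x, continuous (@varphi R)}.
  apply: cvgB.
    apply: (@continuous_comp _ _ _ (fun y : R => 1 + 1 / y ^+ 2)); last first.
      exact: sqrt_continuous.
    apply: cvgD; first exact: cvg_cst.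
    apply: cvgM; first exact: cvg_cst.
    apply: cvgV; first by rewrite expf_neq0// lt0r_neq0.
    by apply: cvgM; exact: cvg_id.
  by apply: cvgM; [exact: cvg_cst|exact: cinv].
apply: cvgD; first by apply: cvgM; [exact: cvg_id|exact: cphi].
apply: (@continuous_comp _ _ _ (fun y : R => 2 / y * varphi y)).
  apply: cvgM; last exact: cphi.
  by apply: cvgM; [exact: cvg_cst|exact: cinv].
apply: continuous_ln; have /andP[p0 _] := varphi_itv x x0.
by rewrite mulr_gt0// divr_gt0.
Qed.

Local Open Scope classical_set_scope.

Theorem corollary2p2 (R : realType) (u : R) (hu : 2 < u)
  (K : nat -> nat) (hK : forall n : nat, (0 < n)%N -> (0 < K n)%N)
  (hKlim : (K n)%:R / (u * n%:R `^ 2^-1) @[n --> \oo] --> (1 : R)) :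
  (forall (m n : nat) (t : R), (0 < m)%N -> (0 < n)%N -> 0 < t ->
    (lne (fluct_pos (mu_ R m n) (@lis_trunc_grid R m n (K n))
            (t * n%:R `^ 4^-1))%:E
      <= (varkappa R
          - vartheta (2 * t * Num.sqrt (n%:R `^ 2^-1 / (K n)%:R)))%:E)%E) /\
  (forall t : R, 0 < t ->
    varkappa R - vartheta (2 * t * Num.sqrt (n%:R `^ 2^-1 / (K n)%:R))
      @[n --> \oo] --> varkappa R - vartheta (2 * t / u `^ 2^-1)).
Proof.
have u0 : 0 < u by lra.
split=> [m n t _ n0 t0|t t0].
  have pn0 : 0 < n%:R `^ 4^-1 :> R by rewrite powR_gt0// ltr0n.
  have tn0 : 0 < t * n%:R `^ 4^-1 by rewrite mulr_gt0.
  have := lis_trunc_grid_tail m n (K n) _ (hK n n0) tn0.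
  have -> : 2 * (t * n%:R `^ 4^-1) / Num.sqrt (K n)%:R =
      2 * t * Num.sqrt (n%:R `^ 2^-1 / (K n)%:R).
    rewrite sqrtrM ?powR_ge0// sqrtrV ?ler0n//.
    rewrite -(powR12_sqrt (powR_ge0 _ _)) -powRrM -invfM.
    by have -> : 2 * 2 = 4 :> R by [ring]; rewrite !mulrA.
  (* When the fluctuation vanishes its logarithm is [-oo] and the bound is trivial. *)
  move=> tail /=; case: ifPn => [_|]; first exact: leNye.
  rewrite -ltNge => F0; rewrite lee_fin -ler_expR lnK//.
(* The hypothesis is inverted and multiplied by [u^-1]; the cancellation is carried out for [n > 0],
   which suffices for the limit. *)
have ratio : n%:R `^ 2^-1 / (K n)%:R @[n --> \oo] --> (u^-1 : R).
  have -> : u^-1 = 1^-1 * u^-1 by rewrite invr1 mul1r.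
  apply: cvg_trans (cvgM (cvgV (oner_neq0 R) hKlim) (cvg_cst u^-1)).
  apply: near_eq_cvg; near=> n.
  have n0 : (0 < n)%N by near: n; exact: nbhs_infty_gt.
  have p0 : n%:R `^ 2^-1 != 0 :> R by rewrite lt0r_neq0// powR_gt0// ltr0n.
  have K0 : (K n)%:R != 0 :> R by rewrite pnatr_eq0 -lt0n hK.
  by rewrite /=; field; rewrite p0 K0 lt0r_neq0.
apply: cvgB; first exact: cvg_cst.
have yE : 2 * t / u `^ 2^-1 = 2 * t * Num.sqrt u^-1.
  by rewrite powR12_sqrt ?ltW// sqrtrV// ltW.
rewrite yE; apply: (cvg_comp (fun n => 2 * t * Num.sqrt (n%:R `^ 2^-1 / (K n)%:R))).
  apply: cvgM; first exact: cvg_cst.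
  by apply: (cvg_comp _ _ ratio); exact: sqrt_continuous.
apply: vartheta_continuous.
by rewrite !mulr_gt0// sqrtr_gt0 invr_gt0.
Unshelve. all: by end_near.
Qed.
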